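(* On a Hilbert space $H$, there is a one-to-one correspondence between, on the one hand, pairs of commuting unitaries $(A,B)$ intertwined by a unitary $C\in\{AB^*\}'$ (that is, triples $(A,B,C)$ of unitaries with $AB=BA$, $CA=BC$ and $C$ commuting with $AB^*$) and, on the other hand, twisted commuting pairs of unitaries $(V,W)$. The correspondence is given by the following relations: (1) given $(V,W)$, take $A=VW$, $B=WV$, $C=V^*$; (2) given $(A,B)$ and $C$, take $V=C^*$, $W=CA$. Moreover, the twist of $(V,W)$ is equal to $AB^*=V^*W^*VW$.
   Context: A pair $(V,W)$ of bounded operators on $H$ is twisted commuting if there is a unitary $U$ commuting with $V$ and $W$ such that $VW=UWV$; $U$ is called the twist. $\{\cdot\}'$ denotes the commutant. *)

(* Defs.v *)
From HB Require Import structures.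
From mathcomp Require Import all_boot all_order all_algebra.
From mathcomp Require Import complex sesquilinear.
From mathcomp Require Import all_classical all_reals all_analysis.

Set Implicit Arguments.
Unset Strict Implicit.
Unset Printing Implicit Defensive.

Import Order.TTheory GRing.Theory Num.Theory numFieldNormedType.Exports.

Local Open Scope classical_set_scope.
Local Open Scope complex_scope.
Local Open Scope ring_scope.

(* Complex Hilbert spaces: the inner product is linear in its first argument
   and induces the norm, for which the space is complete. *)
HB.mixin Record isHilbert (R : realType) H of CompleteNormedModule R[i] H := {
  inner : {dot H for @Num.conj R[i]};
  inner_norm : forall x : H, inner x x = `|x| ^+ 2 }.

#[short(type="hilbertType")]
HB.structure Definition Hilbert (R : realType) :=
  { H of isHilbert R H & CompleteNormedModule R[i] H }.

Section Operators.
Variables (R : realType) (H : hilbertType R).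
Implicit Types A B C S T U V W : H -> H.

Definition bounded_op T := linear T /\ bounded_near T (nbhs (0 : H)).

Definition is_adjoint T S := forall x y : H, inner (T x) y = inner x (S y).

(* For a bounded operator T, such an S exists by the Riesz representation
   theorem and is unique. *)
Definition adjoint T : H -> H := get (is_adjoint T).

Definition unitary U :=
  [/\ bounded_op U, adjoint U \o U = id & U \o adjoint U = id].

Definition commutant (F : set (H -> H)) : set (H -> H) :=
  [set T | bounded_op T /\ forall S, F S -> T \o S = S \o T].

Definition is_twist V W U :=
  [/\ unitary U, U \o V = V \o U, U \o W = W \o U & V \o W = U \o W \o V].

Definition twisted_commuting V W :=
  [/\ bounded_op V, bounded_op W & exists U, is_twist V W U].

Definition twisted_unitary_pairs : set ((H -> H) * (H -> H)) :=
  [set p | let '(V, W) := p in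
     [/\ unitary V, unitary W & twisted_commuting V W]].

Definition intertwined_unitary_triples :
    set ((H -> H) * (H -> H) * (H -> H)) :=
  [set t | let '(A, B, C) := t in
     [/\ unitary A, unitary B & A \o B = B \o A] /\
     [/\ unitary C, C \o A = B \o C & commutant [set A \o adjoint B] C]].

Definition pair_to_triple (p : (H -> H) * (H -> H)) :=
  let '(V, W) := p in (V \o W, W \o V, adjoint V).

Definition triple_to_pair (t : (H -> H) * (H -> H) * (H -> H)) :=
  let '(A, B, C) := t in (adjoint C, C \o A).

End Operators.

(* Main.v *)
Require Import Defs.
From mathcomp Require Import all_boot all_order all_algebra.
From mathcomp Require Import all_classical all_reals all_analysis.
From mathcomp Require Import sesquilinear.

Import Order.TTheory GRing.Theory Num.Theory.

Local Open Scope classical_set_scope.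

(** Everything is cancellation in the group of unitaries. Given a twisted pair
    [V W = U W V], the operators [A = V W] and [B = W V] satisfy [A = U B], so
    the twist is forced to be [A B^*]; it commutes with [V] and [W], hence with
    [B], which makes [A] and [B] commute, and [C = V^*] carries [A] to [B]
    because [V^* (V W) = W = (W V) V^*]. Conversely, if [C A = B C] then
    [V = C^*] and [W = C A] have [V W = A] and [W V = C A C^* = B], so [A B^*]
    is a twist as soon as it commutes with [C] (assumed) and with [A] (which
    commutes with [B], hence with [B^*]). The two maps are mutually inverse by
    the same computations, and mutually inverse maps between two sets are
    bijections ([set_bij_of_inverse]).

    The analytic content is that unitaries do form a group closed under the
    adjoint. The adjoint is obtained by choice, so one first shows that a
    unitary really has one ([unitary_is_adjoint]); uniqueness of adjoints
    ([is_adjoint_unique]) then identifies the adjoints of products and of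
    adjoints, and boundedness comes from unitaries being isometric. *)

Section UnitaryGroup.
Context {R : realType} {H : hilbertType R}.
Implicit Types (x y z : H) (S T U V : H -> H).

Local Open Scope ring_scope.

Lemma inner_inj y z : (forall x, inner x y = inner x z) -> y = z.
Proof.
move=> yz; apply/eqP; rewrite -subr_eq0 -normr_eq0 -sqrf_eq0 -inner_norm.
by rewrite linearBr subr_eq0; apply/eqP; exact: yz.
Qed.

Lemma is_adjoint_unique T S S' : is_adjoint T S -> is_adjoint T S' -> S = S'.
Proof.
by move=> TS TS'; apply/funext => y; apply: inner_inj => x; rewrite -TS TS'.
Qed.

Lemma is_adjointE T S : is_adjoint T S -> adjoint T = S.
Proof.
move=> TS; apply: (is_adjoint_unique T) => //.
by apply: getPex; exists S.
Qed.

Lemma adjointK U : unitary U -> cancel U (adjoint U).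
Proof. by case=> _ /(congr1 (@^~ _)) + _ x; apply. Qed.

Lemma adjointVK U : unitary U -> cancel (adjoint U) U.
Proof. by case=> _ _ /(congr1 (@^~ _)) + x; apply. Qed.

(** The adjoint is a choice among the adjoints of [U], with a constant function
    as default. If there were nothing to choose from, the identity
    [U^* U = id] would make the identity constant, so the space would be a single
    point, where any function is an adjoint of any other. *)
Lemma unitary_is_adjoint U : unitary U -> is_adjoint U (adjoint U).
Proof.
move=> uU; have UK := adjointK U uU.
have [[S US]|noS] := pselect (exists S, is_adjoint U S).
  by apply: getPex; exists S.
have adjE : adjoint U = point by apply: getPN => S US; apply: noS; exists S.
have allE x y : x = y by rewrite -(UK x) -(UK y) adjE.
by move=> x y; rewrite (allE (U x) x) (allE (adjoint U y) y).
Qed.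

Lemma is_adjoint_isometry T S :
  is_adjoint T S -> cancel T S -> forall x, `|T x| = `|x|.
Proof.
move=> TS TK x; apply/eqP; rewrite -(eqrXn2 (n := 2)) // -!inner_norm.
by rewrite TS TK.
Qed.

Lemma isometry_bounded_op T :
  linear T -> (forall x, `|T x| = `|x|) -> bounded_op T.
Proof.
move=> linT isoT; split=> //; apply/ex_bound; exists 1.
by apply/nbhs_norm0P; exists 1 => //= x /= /ltW; rewrite isoT.
Qed.

Lemma unitary_of_adjoint T S :
  linear T -> is_adjoint T S -> cancel T S -> cancel S T -> unitary T.
Proof.
move=> linT TS TK SK; rewrite /unitary (is_adjointE _ _ TS); split.
- exact: isometry_bounded_op (is_adjoint_isometry _ _ TS TK).
- exact/funext.
- exact/funext.
Qed.

Lemma is_adjoint_adjoint U : unitary U -> is_adjoint (adjoint U) U.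
Proof.
move=> uU x y.
by rewrite -{2}(adjointVK U uU x) (unitary_is_adjoint U uU) adjointK.
Qed.

Lemma adjoint_adjoint U : unitary U -> adjoint (adjoint U) = U.
Proof. by move=> uU; exact/is_adjointE/is_adjoint_adjoint. Qed.

Lemma unitary_adjoint U : unitary U -> unitary (adjoint U).
Proof.
move=> uU; have UK := adjointK U uU; have UVK := adjointVK U uU.
apply: unitary_of_adjoint (is_adjoint_adjoint U uU) _ _ => // a x y.
case: uU => [[linU _] _ _].
by apply: (can_inj UK); rewrite linU !UVK.
Qed.

Lemma unitary_comp U V : unitary U -> unitary V -> unitary (U \o V).
Proof.
move=> uU uV; apply: (unitary_of_adjoint _ (adjoint V \o adjoint U)).
- case: uU uV => [[linU _] _ _] [[linV _] _ _] a x y.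
  by rewrite /= linV linU.
- by move=> x y; rewrite /= !unitary_is_adjoint.
- by move=> x; rewrite /= !adjointK.
- by move=> x; rewrite /= !adjointVK.
Qed.

Lemma commute_adjoint T U : unitary U ->
  T \o U = U \o T -> T \o adjoint U = adjoint U \o T.
Proof.
move=> uU TU; apply/funext => x /=; apply: (can_inj (adjointK U uU)).
have /= <- := congr1 (@^~ (adjoint U x)) TU.
by rewrite !adjointVK.
Qed.

End UnitaryGroup.

Lemma set_bij_of_inverse {T T' : Type} (D : set T) (E : set T')
    (f : T -> T') (g : T' -> T) :
  (forall x, D x -> E (f x)) -> (forall y, E y -> D (g y)) ->
  (forall x, D x -> g (f x) = x) -> (forall y, E y -> f (g y) = y) ->
  set_bij D E f.
Proof.
move=> fE gD fK gK; split=> // [x y|y Ey].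
  by move=> /set_mem Dx /set_mem Dy fxy; rewrite -(fK x) // fxy fK.
by exists (g y); [exact: gD | exact: gK].
Qed.

Section Correspondence.
Context {R : realType} {H : hilbertType R}.
Implicit Types A B C U V W : H -> H.

Lemma twistE V W U : unitary V -> unitary W -> is_twist V W U ->
  U = (V \o W) \o adjoint (W \o V).
Proof.
move=> uV uW [_ _ _ ->]; apply/funext => x /=.
by have /= -> := adjointVK _ (unitary_comp _ _ uW uV) x.
Qed.

Lemma twist_commutatorE V W U : unitary V -> unitary W -> is_twist V W U ->
  U = adjoint V \o adjoint W \o V \o W.
Proof.
move=> uV uW [_ UV UW VW]; apply/funext => x /=.
have /= -> := congr1 (@^~ x) VW.
have /= -> := congr1 (@^~ (V x)) UW.
have /= -> := congr1 (@^~ x) UV.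
by rewrite !adjointK.
Qed.

Lemma pair_to_triple_intertwined (p : (H -> H) * (H -> H)) :
  twisted_unitary_pairs p -> intertwined_unitary_triples (pair_to_triple p).
Proof.
case: p => V W /= [uV uW [_ _ [U twU]]].
have UE := twistE V W U uV uW twU.
case: twU => uU UV UW VW.
have uVa := unitary_adjoint V uV.
split; split=> //.
- exact: unitary_comp.
- exact: unitary_comp.
- (* Both products are [U] times the square of [W V]. *)
  apply/funext => x.
  have UVx := fun x => congr1 (@^~ x) UV.
  have UWx := fun x => congr1 (@^~ x) UW.
  have VWx := fun x => congr1 (@^~ x) VW.
  rewrite /= in UVx UWx VWx *.
  by rewrite (VWx (W (V x))) (VWx x) -UVx -UWx.
- by apply/funext => x /=; rewrite adjointK // adjointVK.
- split; first by case: uVa.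
  by move=> _ ->; rewrite -UE; apply/esym/commute_adjoint.
Qed.

Lemma triple_to_pair_twisted (t : (H -> H) * (H -> H) * (H -> H)) :
  intertwined_unitary_triples t -> twisted_unitary_pairs (triple_to_pair t).
Proof.
case: t => [[A B] C] /= [[uA uB AB] [uC CA [_ /(_ _ erefl) CU]]].
have uCa := unitary_adjoint C uC; have uBa := unitary_adjoint B uB.
have uCA := unitary_comp C A uC uA.
split=> //; split; [by case: uCa | by case: uCA |].
have UA : (A \o adjoint B) \o A = A \o (A \o adjoint B).
  by rewrite -compA -(commute_adjoint A B).
exists (A \o adjoint B); split.
- exact: unitary_comp.
- exact: commute_adjoint.
- by rewrite compA -CU -compA UA compA.
- apply/funext => x /=; rewrite adjointK //.
  have /= -> := congr1 (@^~ (adjoint C x)) CA.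
  by rewrite (adjointVK C) // (adjointK B).
Qed.

Lemma pair_to_tripleK (p : (H -> H) * (H -> H)) :
  twisted_unitary_pairs p -> triple_to_pair (pair_to_triple p) = p.
Proof.
case: p => V W /= [uV uW _]; rewrite adjoint_adjoint //; congr (_, _).
by apply/funext => x /=; rewrite adjointK.
Qed.

Lemma triple_to_pairK (t : (H -> H) * (H -> H) * (H -> H)) :
  intertwined_unitary_triples t -> pair_to_triple (triple_to_pair t) = t.
Proof.
case: t => [[A B] C] /= [_ [uC CA _]]; rewrite adjoint_adjoint //.
congr (_, _, _); apply/funext => x /=; first by rewrite adjointK.
have /= -> := congr1 (@^~ (adjoint C x)) CA.
by rewrite adjointVK.
Qed.

End Correspondence.

Theorem proposition5p1 (R : realType) (H : hilbertType R) :
  [/\ set_bij (@twisted_unitary_pairs R H) (@intertwined_unitary_triples R H)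
        (@pair_to_triple R H),
      set_bij (@intertwined_unitary_triples R H) (@twisted_unitary_pairs R H)
        (@triple_to_pair R H),
      (forall p : (H -> H) * (H -> H), twisted_unitary_pairs p ->
         triple_to_pair (pair_to_triple p) = p),
      (forall t : (H -> H) * (H -> H) * (H -> H),
         intertwined_unitary_triples t ->
         pair_to_triple (triple_to_pair t) = t) &
      forall V W : H -> H, twisted_unitary_pairs (V, W) ->
        let '(A, B, C) := pair_to_triple (V, W) in
        (forall U : H -> H, is_twist V W U <-> U = A \o adjoint B) /\
        A \o adjoint B = adjoint V \o adjoint W \o V \o W].
Proof.
split.
- exact: (set_bij_of_inverse _ _ _ _ pair_to_triple_intertwined
    triple_to_pair_twisted pair_to_tripleK triple_to_pairK).
- exact: (set_bij_of_inverse _ _ _ _ triple_to_pair_twisted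
    pair_to_triple_intertwined triple_to_pairK pair_to_tripleK).
- exact: pair_to_tripleK.
- exact: triple_to_pairK.
move=> V W /= [uV uW [_ _ [U twU]]].
have UE := twistE V W U uV uW twU.
split=> [U'|]; last by rewrite -UE; exact: twist_commutatorE.
by split=> [|->]; [exact: twistE | rewrite -UE].
Qed.
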